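(* For all strictly positive rationals $U,b$ and all rational $\mu\in(0,U)$, with $\gamma=\mu/U$, $$\lim_{T\to\infty}\frac{\mathrm{Opt}^T_{\mathbf{MAR}}(\mu,U,b)}{\mathrm{Opt}^T_{\mathbf{IND}}(\mu,U,b)}=\begin{cases}1-\gamma^{1/b}&\text{if }\mu\le\frac{U}{b+1},\\[4pt] \dfrac{(1-\gamma^{1/b})\,b\mu}{U-\mu}&\text{if }\mu>\frac{U}{b+1}.\end{cases}$$
   Context: For each integer $T\ge1$ (empty products equal 1): for integers $j\in[-1,T-1]$, $A^T_j=U\prod_{k=j+1}^{T-1}\frac{k}{b+k}$, and $A^T_T=\frac{b+T}{T}U$; for $j\in[-1,T]$, $B^T_j=\frac{j}{b+T}A^T_j$; for $j\in[0,T]$, $G^T_j(x,\mu)=\big(T-\frac{b+T}{A^T_j}\mu\big)x+(T-j)b\mu$. For $\mu>0$, $\Gamma^T_\mu=j+1$ if $\mu\in(A^{T+1}_j,A^{T+1}_{j+1}]$, $j\in[-1,T-1]$. $\beta^T_\mu=B^T_{\Gamma^T_\mu}$ and $$\mathrm{Opt}^T_{\mathbf{MAR}}(\mu,U,b)=G^T_{\Gamma^T_\mu}(\beta^T_\mu,\mu).$$ This is the optimal value (for initial inventory $x_0\le\beta^T_\mu$) of the $T$-period minimax newsvendor problem with holding cost 1, backorder cost $b$, in which nature picks any martingale demand with mean $\mu$ and support in $[0,U]\cap\mathbb Q$. Also $$\mathrm{Opt}^T_{\mathbf{IND}}(\mu,U,b)=\begin{cases} Tb\mu & \mu\le\frac{U}{b+1},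 \\ T(U-\mu) & \mu>\frac{U}{b+1}, \end{cases}$$ which is the corresponding value when nature must pick demands independent across periods, each with mean $\mu$ and support in $[0,U]\cap\mathbb Q$ (for sufficiently small $x_0$, e.g. $x_0=0$). *)

(* Defs.v *)
From HB Require Import structures.
From mathcomp Require Import all_boot all_order all_algebra.

Set Implicit Arguments.
Unset Strict Implicit.
Unset Printing Implicit Defensive.

Import Order.TTheory GRing.Theory Num.Theory.
Local Open Scope ring_scope.

(* The parameters are ordered U, b, T (horizon), then the index j, an integer
   because it may be -1.  Meaningful for T >= 1 and -1 <= j <= T. *)

(* The factors k = j+1, ..., T-1 are the k < T with j < k.  For j = -1 the
   product includes the factor 0 / (b + 0), so that A U b T (-1) = 0. *)
Definition A (F : realFieldType) (U b : F) (T : nat) (j : int) : F :=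
  if j == T%:Z then (b + T%:R) / T%:R * U
  else U * \prod_(k < T | (j < k%:Z)%R) (k%:R / (b + k%:R)).

Definition B (F : realFieldType) (U b : F) (T : nat) (j : int) : F :=
  j%:~R / (b + T%:R) * A U b T j.

Definition G (F : realFieldType) (U b : F) (T : nat) (j : int) (x mu : F) : F :=
  (T%:R - (b + T%:R) / A U b T j * mu) * x + (T%:R - j%:~R) * b * mu.

(* The index i plays the role of j + 1, so it ranges over 0, ..., T; the
   thresholds are those of horizon T + 1.  For 0 < mu <= U and 0 < b these
   intervals partition ]0, U], so i exists and is unique; otherwise the value
   0 is a placeholder. *)
Definition Gamma (F : realFieldType) (U b : F) (T : nat) (mu : F) : int :=
  if [pick i : 'I_T.+1 |
        A U b T.+1 (i%:Z - 1) < mu <= A U b T.+1 i%:Z] is Some i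
  then i%:Z else 0.

Definition beta (F : realFieldType) (U b : F) (T : nat) (mu : F) : F :=
  B U b T (Gamma U b T mu).

Definition OptMAR (F : realFieldType) (T : nat) (mu U b : F) : F :=
  G U b T (Gamma U b T mu) (beta U b T mu) mu.

Definition OptIND (F : realFieldType) (T : nat) (mu U b : F) : F :=
  if mu <= U / (b + 1) then T%:R * b * mu else T%:R * (U - mu).

(* Main.v *)
Require Import Defs.
From HB Require Import structures.
From mathcomp Require Import all_boot all_order all_algebra.
From mathcomp Require Import all_classical all_reals all_analysis.
From mathcomp Require Import lra ring.

Set Implicit Arguments.
Unset Strict Implicit.
Unset Printing Implicit Defensive.

Import Order.TTheory GRing.Theory Num.Theory.
Import numFieldNormedType.Exports.
Local Open Scope classical_set_scope.
Local Open Scope ring_scope.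

(** Write [A_j] for the thresholds of horizon [T + 1], [i] for [Gamma] and
    [r] for [(mu / U) `^ (1 / b)]. Substituting [beta] into [G] gives
    (OptMAR_threshold)
      [OptMAR = i * (A_i - mu) + (T - i) * b * mu].
    Since [A_(i-1) < mu <= A_i] and [A_(i-1) = i / (b + i) * A_i], the first
    summand lies between [0] and [b * mu]. Hence [OptMAR / T] is
    [b * mu * (1 - i / T)] up to [O(1 / T)], and everything rests on
    [i / T --> r].

    The thresholds behave like a power: [A_j] is about [U * (j / T) `^ b].
    Precisely (threshold_ge_powR, threshold_le_powR),
      [U * (j / T) `^ b <= A_j <= U * ((j + b + 1) / (T + b + 1)) `^ b].
    Both sides follow by descending induction on [j] from [A_T = U]; the
    inductive step in each case is an instance of the weighted inequality of
    arithmetic and geometric means (powR_amgm). Taking [b]-th roots at the two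
    thresholds that enclose [mu] yields [i - 1 <= T * r] and
    [r * (T + b + 1) <= i + b + 1], so [i - T * r] is bounded uniformly in [T].

    Altogether [OptMAR] differs from [T * b * mu * (1 - r)] by a constant bound
    (OptMAR_bound). As [OptIND] is exactly linear in [T], the ratio converges
    to the ratio of the two slopes. *)

Lemma threshold_last (F : realFieldType) (U b : F) (T : nat) :
  A U b T.+1 T%:Z = U.
Proof.
rewrite /A eqz_nat ltn_eqF // big_pred0 ?mulr1 // => k.
by rewrite ltz_nat ltnNge -ltnS ltn_ord.
Qed.

(** The recurrence holds down to [i = 0] because of the vanishing factor
    [0 / (b + 0)]; together with [threshold_last] it determines the thresholds,
    and the estimates below use nothing else about the product. *)
Lemma threshold_pred (F : realFieldType) (U b : F) (T i : nat) : (i <= T)%N ->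
  A U b T.+1 (i%:Z - 1) = i%:R / (b + i%:R) * A U b T.+1 i%:Z.
Proof.
move=> leiT; have ltiT : (i < T.+1)%N by [].
have /negPf neqP : i%:Z - 1 != T.+1%:Z.
  by rewrite subr_eq addrC intS -intS eqz_nat ltn_eqF // ltnW.
rewrite /A neqP eqz_nat (ltn_eqF ltiT) (bigD1 (Ordinal ltiT)) /=; last first.
  by rewrite ltrBlDr addrC -intS ltz_nat.
rewrite mulrCA; congr (_ * (_ * _)); apply: eq_bigl => k.
by rewrite ltrBlDr addrC -intS !ltz_nat ltnS -val_eqE /= ltn_neqAle eq_sym
  andbC.
Qed.

(** The optimal value is written with the thresholds of horizon [T], whereas
    [Gamma] is read off those of horizon [T.+1]. The products differ by the factor
    [T / (b + T)]; the exceptional value at [j = T] makes the same proportionality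
    hold there. *)
Lemma threshold_horizon (F : realFieldType) (U b : F) (T j : nat)
    (b_gt0 : 0 < b) :
  (0 < T)%N -> (j <= T)%N ->
  A U b T j%:Z = (b + T%:R) / T%:R * A U b T.+1 j%:Z.
Proof.
move=> T_gt0 lejT; have T0 : 0 < T%:R :> F by rewrite ltr0n.
have [->|neqjT] := eqVneq j T; first by rewrite threshold_last /A eqxx.
have ltjT : (j < T)%N by rewrite ltn_neqAle neqjT.
rewrite /A !eqz_nat (ltn_eqF ltjT) (ltn_eqF (ltnW _)) ?ltnS //.
rewrite [in RHS]big_mkcond big_ord_recr /= -big_mkcond /= ltz_nat ltjT.
by field; apply/andP; split; lra.
Qed.

Lemma threshold_gt0 (F : realFieldType) (U b : F) (T j : nat)
    (U_gt0 : 0 < U) (b_gt0 : 0 < b) :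
  0 < A U b T.+1 j%:Z.
Proof.
rewrite /A; case: ifP => _.
  by rewrite mulr_gt0 // divr_gt0 ?ltr0n // addr_gt0 // ltr0n.
rewrite mulr_gt0 // prodr_gt0 // => k; rewrite ltz_nat => ltjk.
have k0 : 0 < (k : nat)%:R :> F by rewrite ltr0n (leq_ltn_trans _ ltjk).
by rewrite divr_gt0 // addr_gt0.
Qed.

(** The thresholds run from [0] at index [-1] to [U] at index [T], so the least
    index whose threshold reaches [mu] satisfies the condition tested by
    [Gamma], whose default value is therefore never taken. *)
Lemma Gamma_spec (F : realFieldType) (U b : F) (T : nat) (mu : F) :
  0 < mu <= U ->
  exists2 i : nat, (i <= T)%N & Gamma U b T mu = i%:Z /\
    A U b T.+1 (i%:Z - 1) < mu <= A U b T.+1 i%:Z.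
Proof.
move=> /andP[mu_gt0 mu_leU]; rewrite /Gamma; case: pickP => [i iP|noP].
  by exists i => //; rewrite -ltnS.
have exA : exists i : nat, mu <= A U b T.+1 i%:Z.
  by exists T; rewrite threshold_last.
case: (ex_minnP exA) => i leA minA.
have leiT : (i < T.+1)%N by rewrite ltnS minA // threshold_last.
move: (noP (Ordinal leiT)) => /=; rewrite leA andbT => /negP[].
case: i leiT minA {leA} => [|i] leiT minA.
  by rewrite threshold_pred // mul0r mul0r.
rewrite intS addrC addKr ltNge; apply/negP => /minA; by rewrite ltnn.
Qed.

(** At the inventory [beta] the nested formula collapses: by [threshold_horizon]
    the factor [T * A / (b + T)] is the threshold of horizon [T.+1]. The second
    summand carries the growth in [T]; the first stays bounded because
    consecutive thresholds enclose [mu]. *)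
Lemma OptMAR_threshold (F : realFieldType) (U b : F) (T i : nat)
    (mu : F) (U_gt0 : 0 < U) (b_gt0 : 0 < b) :
  (0 < T)%N -> (i <= T)%N -> Gamma U b T mu = i%:Z ->
  OptMAR T mu U b =
    i%:R * (A U b T.+1 i%:Z - mu) + (T%:R - i%:R) * b * mu.
Proof.
move=> T_gt0 leiT eqG; have T0 : 0 < T%:R :> F by rewrite ltr0n.
rewrite /OptMAR /beta eqG /G /B threshold_horizon // -pmulrn.
have A0 := threshold_gt0 T i U_gt0 b_gt0.
by field; apply/and3P; split; lra.
Qed.

(** The weighted inequality of arithmetic and geometric means for the numbers
    [y + s] and [y - s * b], with weights [b] and [1]; their weighted mean is
    [y]. It follows from [1 + x <= expR x] applied to each factor relative to [y], as
    the two exponents cancel. *)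
Lemma powR_amgm (R : realType) (b y s : R) (b_gt0 : 0 < b) :
  0 < y -> 0 <= y + s ->
  (y + s) `^ b * (y - s * b) <= y `^ b * y.
Proof.
move=> y_gt0 ys_ge0.
have le1 : (y + s) `^ b <= y `^ b * expR (s / y * b).
  rewrite expRM -powRM ?expR_ge0 ?(ltW y_gt0) //.
  apply: (ge0_ler_powR (ltW b_gt0)) => //.
    by rewrite nnegrE mulr_ge0 ?expR_ge0 // ltW.
  have -> : y + s = y * (1 + s / y) by field; lra.
  by rewrite ler_pM2l // expR_ge1Dx.
have le2 : y - s * b <= y * expR (- (s / y * b)).
  have -> : y - s * b = y * (1 + - (s / y * b)) by field; lra.
  by rewrite ler_pM2l // expR_ge1Dx.
(* A negative second factor makes the left-hand side nonpositive. *)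
have [ysb_le0|/ltW ysb_ge0] := lerP (y - s * b) 0.
  by rewrite (le_trans (mulr_ge0_le0 (powR_ge0 _ _) ysb_le0)) //
    mulr_ge0 ?powR_ge0 ?ltW.
apply: le_trans (ler_pM (powR_ge0 _ _) ysb_ge0 le1 le2) _.
by rewrite mulrACA -expRD subrr expR0 mulr1.
Qed.

(** In other words [A_i / i `^ b] decreases with [i], which is [powR_amgm] at
    [y = i + 1], [s = -1]. The comparison ends at [i = T], where [A_T = U]. *)
Lemma threshold_ge_powR (R : realType) (U b : R) (T i : nat)
    (U_gt0 : 0 < U) (b_gt0 : 0 < b) :
  (i <= T)%N ->
  U * i%:R `^ b <= A U b T.+1 i%:Z * T%:R `^ b.
Proof.
move=> /subnKC; move: (T - i)%N => d; elim: d i => [|d IHd] i.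
  by rewrite addn0 => <-; rewrite threshold_last.
rewrite addnS -addSn => iT.
have ltiT : (i < T)%N by rewrite -iT addSn ltnS leq_addr.
have {IHd iT} IH := IHd _ iT.
have y0 : 0 < i.+1%:R :> R by rewrite ltr0n.
have yb : 0 < b + i.+1%:R by rewrite addr_gt0.
have := powR_amgm b_gt0 y0 (s := -1).
rewrite -natr1 addrK natr1 ler0n => /(_ isT).
rewrite mulN1r opprK => step.
have := @threshold_pred _ U b T i.+1 ltiT.
rewrite {1}intS addrC addKr => ->.
rewrite -(ler_pM2r yb).
have -> : i.+1%:R / (b + i.+1%:R) * A U b T.+1 i.+1 * T%:R `^ b *
  (b + i.+1%:R) = i.+1%:R * (A U b T.+1 i.+1 * T%:R `^ b) by field; lra.
apply: le_trans (ler_wpM2l (ltW y0) IH).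
by rewrite -mulrA [leRHS]mulrCA ler_pM2l // (addrC b) (mulrC i.+1%:R).
Qed.

(** In other words [A_i / (i + b + 1) `^ b] increases with [i], which is
    [powR_amgm] at [y = i + 1 + b], [s = 1]; the shift by [b] is what makes
    [y - s * b] equal to the numerator [i + 1] of the ratio of thresholds. *)
Lemma threshold_le_powR (R : realType) (U b : R) (T i : nat)
    (U_gt0 : 0 < U) (b_gt0 : 0 < b) :
  (i <= T)%N ->
  A U b T.+1 i%:Z * (T%:R + b + 1) `^ b <= U * (i%:R + b + 1) `^ b.
Proof.
move=> /subnKC; move: (T - i)%N => d; elim: d i => [|d IHd] i.
  by rewrite addn0 => <-; rewrite threshold_last.
rewrite addnS -addSn => iT.
have ltiT : (i < T)%N by rewrite -iT addSn ltnS leq_addr.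
have {IHd iT} IH := IHd _ iT.
have y0 : 0 < i.+1%:R :> R by rewrite ltr0n.
have yb : 0 < i.+1%:R + b by rewrite addr_gt0.
have /(_ ltac:(lra)) := powR_amgm b_gt0 yb (s := 1).
rewrite mul1r addrK => step.
have := @threshold_pred _ U b T i.+1 ltiT.
rewrite {1}intS addrC addKr => ->.
rewrite -(ler_pM2r yb).
have -> : i.+1%:R / (b + i.+1%:R) * A U b T.+1 i.+1 * (T%:R + b + 1) `^ b *
  (i.+1%:R + b) = i.+1%:R * (A U b T.+1 i.+1 * (T%:R + b + 1) `^ b).
  by field; lra.
apply: le_trans (ler_wpM2l (ltW y0) IH) _.
have -> : i%:R + b + 1 = i.+1%:R + b by rewrite -natr1; ring.
by rewrite -mulrA mulrCA ler_pM2l // mulrC.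
Qed.

(** Inverting the two power bounds at the thresholds around [mu] confines
    [Gamma] to a window of bounded width around [T * (mu / U) `^ (1 / b)], which
    determines the optimal value up to a constant. In the constant, [b + 1]
    comes from the width of the window and [1] from the bounded summand of
    [OptMAR_threshold]. *)
Lemma OptMAR_bound (R : realType) (U b : R) (T : nat) (mu : R)
    (U_gt0 : 0 < U) (b_gt0 : 0 < b) :
  (0 < T)%N -> 0 < mu < U ->
  `|OptMAR T mu U b - T%:R * (b * mu * (1 - (mu / U) `^ (1 / b)))|
    <= b * mu * (b + 2).
Proof.
move=> T_gt0 /andP[mu_gt0 mu_ltU]; set r := (mu / U) `^ _.
have T0 : 0 < T%:R :> R by rewrite ltr0n.
have r_ge0 : 0 <= r by apply: powR_ge0.
have g_gt0 : 0 < mu / U by rewrite divr_gt0.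
have rb : U * r `^ b = mu.
  by rewrite -powRrM mul1r mulVf ?gt_eqF // powRr1 ?ltW // mulrC divfK ?gt_eqF.
have r_le1 : r <= 1.
  have <- : 1 `^ (1 / b) = 1 :> R by rewrite powR1.
  apply: ge0_ler_powR; rewrite ?nnegrE ?ltW //.
    by rewrite divr_gt0.
  by rewrite ltr_pdivrMr // mul1r.
have [|i leiT [eqG /andP[ltA leA]]] := Gamma_spec b T (mu := mu) (U := U).
  by rewrite mu_gt0 ltW.
rewrite (OptMAR_threshold U_gt0 b_gt0 T_gt0 leiT eqG).
have i0 : 0 <= i%:R :> R by rewrite ler0n.
(* The threshold just below [mu], bounded below by a power of [i - 1]. *)
have i_le : i%:R <= T%:R * r + 1.
  case: i leiT ltA {leA eqG i0} => [|i] leiT.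
    by move=> _; have := mulr_ge0 (ltW T0) r_ge0; lra.
  rewrite intS addrC addKr -natr1 lerD2r => ltA; rewrite leNgt; apply/negP.
  move=> /(gt0_ltr_powR b_gt0); rewrite !nnegrE ler0n mulr_ge0 ?(ltW T0) //.
  move=> /(_ isT isT); rewrite -(ltr_pM2l U_gt0) ltNge => /negP[].
  apply: le_trans (threshold_ge_powR U_gt0 b_gt0 (ltnW leiT)) _.
  by rewrite powRM ?(ltW T0) // mulrCA rb mulrC ler_pM2l ?powR_gt0 // ltW.
(* The threshold just above [mu], bounded above by a power of [i + b + 1]. *)
have le_i : r * (T%:R + b + 1) <= i%:R + b + 1.
  rewrite leNgt; apply/negP => /(gt0_ltr_powR b_gt0).
  rewrite !nnegrE ?mulr_ge0 ?addr_ge0 ?(ltW b_gt0) ?(ltW T0) // => /(_ isT isT).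
  rewrite powRM //; last by lra.
  rewrite -(ltr_pM2l U_gt0) mulrA rb ltNge => /negP[].
  apply: le_trans (threshold_le_powR U_gt0 b_gt0 leiT).
  by rewrite ler_pM2r // powR_gt0; lra.
(* [A_(i-1) < mu] says that [i * A_i < mu * (b + i)]. *)
have gapA : i%:R * (A U b T.+1 i - mu) <= b * mu.
  have bi : 0 < b + i%:R by lra.
  move: ltA; rewrite threshold_pred // mulrAC ltr_pdivrMr // => ltA; lra.
have gapA_ge0 : 0 <= i%:R * (A U b T.+1 i - mu) by rewrite mulr_ge0 // subr_ge0.
have bmu : 0 < b * mu by rewrite mulr_gt0.
have -> : forall a, a + (T%:R - i%:R) * b * mu - T%:R * (b * mu * (1 - r)) =
  a + b * mu * (T%:R * r - i%:R) by move=> a; ring.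
have up : b * mu * (T%:R * r - i%:R) <= b * mu * (b + 1).
  rewrite ler_pM2l //; have : 0 <= r * (b + 1) by rewrite mulr_ge0 //; lra.
  lra.
have lo : b * mu * (-1) <= b * mu * (T%:R * r - i%:R).
  by rewrite ler_pM2l //; lra.
have : 0 <= b * mu * b by rewrite mulr_ge0 // ltW.
by rewrite ler_norml => bmub; apply/andP; split; lra.
Qed.

Lemma cvg_bounded_defect (R : realType) (u : R^nat) (l C : R) :
  (forall T, (0 < T)%N -> `|u T - T%:R * l| <= C) ->
  u T / T%:R @[T --> \oo] --> l.
Proof.
move=> uC; rewrite -cvg_shiftS.
have hC0 (c : R) : l + c * harmonic T @[T --> \oo] --> l.
  rewrite -[X in _ --> X]addr0 -[X in _ --> _ + X](mulr0 c).
  apply: cvgD; first exact: cvg_cst.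
  by apply: cvgM; [exact: cvg_cst|exact: cvg_harmonic].
apply: (squeeze_cvgr _ (hC0 (- C)) (hC0 C)); apply: nearW => T /=.
have T0 : 0 < T.+1%:R :> R by rewrite ltr0n.
have := uC T.+1 isT; rewrite ler_norml => /andP[lo up].
have e c : (l + c / T.+1%:R) = (c + T.+1%:R * l) / T.+1%:R by field; lra.
by rewrite /harmonic !e !ler_pM2r ?invr_gt0 //; apply/andP; split; lra.
Qed.

Lemma cvg_OptMAR_OptIND (R : realType) (U b mu : R) :
  0 < U -> 0 < b -> 0 < mu < U ->
  OptMAR T mu U b / OptIND T mu U b @[T --> \oo] -->
    (if mu <= U / (b + 1) then 1 - (mu / U) `^ (1 / b)
     else (1 - (mu / U) `^ (1 / b)) * b * mu / (U - mu)).
Proof.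
move=> U_gt0 b_gt0 /[dup] muU /andP[mu_gt0 mu_ltU].
have := cvg_bounded_defect (fun T T_gt0 => OptMAR_bound U_gt0 b_gt0 T_gt0 muU).
move: (_ `^ _) => r; rewrite /OptIND; case: ifP => _ lim.
- have -> : 1 - r = b * mu * (1 - r) * (b * mu)^-1.
    by field; apply/andP; split; lra.
  under eq_fun do rewrite -(mulrA _ b) invfM mulrA.
  by apply: cvgM => //; exact: cvg_cst.
- have -> : (1 - r) * b * mu = b * mu * (1 - r) by ring.
  under eq_fun do rewrite invfM mulrA.
  by apply: cvgM => //; exact: cvg_cst.
Qed.

Theorem theorem6 (R : realType) (U b mu : rat)
    (U_gt0 : 0 < U) (b_gt0 : 0 < b) (mu_gt0 : 0 < mu) (mu_ltU : mu < U) :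
  let U' : R := ratr U in
  let b' : R := ratr b in
  let mu' : R := ratr mu in
  let gamma : R := mu' / U' in
  (fun T : nat => OptMAR T mu' U' b' / OptIND T mu' U' b') @ \oo -->
    (if mu' <= U' / (b' + 1) then 1 - gamma `^ (1 / b')
     else (1 - gamma `^ (1 / b')) * b' * mu' / (U' - mu')).
Proof.
by move=> U' b' mu' gamma; apply: cvg_OptMAR_OptIND;
  rewrite ?ltr_rat ?ltr0q // mu_gt0.
Qed.
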